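(* Consider the weakly-constrained 4D-Var problem of minimizing $J$ over $\mathbb{R}^s$, and let $\{x_k\}_{k\ge 0}$, $\{\delta x_k\}_{k\ge 0}$, $\{\alpha_k\}_{k\geq 0}$ be any infinite sequences generated by the globalized SADDLE algorithm from an arbitrary starting point $x_0\in\mathbb{R}^s$, where $J$, the quadratic models $q_k$ and the algorithm are as defined in the context. Write $g_k=\nabla J(x_k)$. Then: (i) the steps are gradient related: there exist constants $0<\kappa_1\le\kappa_2$, independent of $k$, such that for all $k\ge 0$ $$g_k^T\delta x_k\le -\kappa_1\|g_k\|^2\quad\text{and}\quad \|\delta x_k\|\le \kappa_2\|g_k\|;$$ (ii) the objective values decrease monotonically: $J(x_{k+1})\le J(x_k)$ for all $k\ge 0$; (iii) if, in addition, the condition numbers of the Hessians $\nabla^2 q_k(0)$ are bounded uniformly in $k$, then the outer Gauss-Newton iteration converges in the sense that $\lim_{k\to\infty}\|g_k\|=0$.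
   Context: $\|\cdot\|$ is the Euclidean norm, and for a symmetric positive-definite matrix $W$, $\|v\|_W^2=v^TWv$. Problem. Let $N\ge 1$ (number of time sub-windows), $n\ge 1$, $s=n(N+1)$, and write $x=(x^{(0)},\dots,x^{(N)})\in\mathbb{R}^s$ with $x^{(j)}\in\mathbb{R}^n$. Given are $x_b\in\mathbb{R}^n$, $y_j\in\mathbb{R}^{m_j}$ ($0\le j\le N$), continuously differentiable maps $\mathcal{H}_j:\mathbb{R}^n\to\mathbb{R}^{m_j}$ ($0\le j\le N$) and $\mathcal{M}_j:\mathbb{R}^n\to\mathbb{R}^n$ ($1\le j\le N$), and symmetric positive-definite matrices $B,Q_1,\dots,Q_N\in\mathbb{R}^{n\times n}$ and $R_j\in\mathbb{R}^{m_j\times m_j}$. The objective is $$J(x)=\tfrac12\|x^{(0)}-x_b\|_{B^{-1}}^2+\tfrac12\sum_{j=0}^{N}\|\mathcal{H}_j(x^{(j)})-y_j\|_{R_j^{-1}}^2+\tfrac12\sum_{j=1}^{N}\|x^{(j)}-\mathcal{M}_j(x^{(j-1)})\|_{Q_j^{-1}}^2 .$$ Quadratic model. At an iterate $x_k\in\mathbb{R}^s$, let $M_j$ be the Jacobian of $\mathcal{M}_j$ at $x_k^{(j-1)}$ and $H_j$ the Jacobian of $\mathcal{H}_j$ at $x_k^{(j)}$. Let $L=L_k\in\mathbb{R}^{s\times s}$ be the block lower bidiagonal matrix with identity diagonal blocks and subdiagonal blocks $-M_1,\dots,-M_N$, let $H=H_k=\mathrm{diag}(H_0,\dots,H_N)$,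 $D=\mathrm{diag}(B,Q_1,\dots,Q_N)$, $R=\mathrm{diag}(R_0,\dots,R_N)$. Let $b=b_k=(b_0,c_1,\dots,c_N)$ with $b_0=x_b-x_k^{(0)}$, $c_j=\mathcal{M}_j(x_k^{(j-1)})-x_k^{(j)}$, and $d=d_k=(d_0,\dots,d_N)$ with $d_j=y_j-\mathcal{H}_j(x_k^{(j)})$. The Gauss-Newton quadratic model is $$q_k(\delta x)=\tfrac12\|L\,\delta x-b\|_{D^{-1}}^2+\tfrac12\|H\,\delta x-d\|_{R^{-1}}^2,\qquad \delta x\in\mathbb{R}^s,$$ so that $q_k(0)=J(x_k)$, $\nabla q_k(0)=\nabla J(x_k)$ and $\nabla^2q_k=L^TD^{-1}L+H^TR^{-1}H$. Globalized SADDLE algorithm. Fixed data: $\epsilon_q\in(0,1)$ and non-negative numbers $\theta_j$ (indexed by the inner iteration number $j\geq 1$, with $\theta_j\to 0$). At outer iteration $k$: 1. Compute $J(x_k)$ and $g_k=\nabla J(x_k)$. 2. Apply a (preconditioned GMRES) iterative solver to the saddle system $$\begin{pmatrix} D&0&L\\0&R&H\\L^T&H^T&0\end{pmatrix}\begin{pmatrix}\delta\lambda\\ \delta\mu\\ \delta x\end{pmatrix}=\begin{pmatrix}b\\d\\0\end{pmatrix},$$ terminating at some inner iteration $j$ with a triple $(\delta\lambda,\delta\mu,\delta x)$ such that either $$q_k(0)-q_k(\delta x)\ \ge\ \max\big[\epsilon_q\min[1,\|g_k\|^2],\ \theta_j\big],$$ or the saddle system is solved to full accuracy (i.e. exactly).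 Set $\delta x_k=\delta x$. 3. Perform a backtracking linesearch on $J$ along $\delta x_k$: with fixed constants $\bar\alpha>0$ and $\rho,c\in(0,1)$, let $\alpha_k$ be the first element of the sequence $\bar\alpha,\rho\bar\alpha,\rho^2\bar\alpha,\dots$ satisfying $J(x_k+\alpha_k\delta x_k)\le J(x_k)+c\,\alpha_k\,g_k^T\delta x_k$. Set $x_{k+1}=x_k+\alpha_k\delta x_k$. *)

(* Defs.v *)
From HB Require Import structures.
From mathcomp Require Import all_boot all_order all_algebra.
From mathcomp Require Import all_classical all_reals all_analysis.

Set Implicit Arguments.
Unset Strict Implicit.
Unset Printing Implicit Defensive.

Import Order.TTheory GRing.Theory Num.Theory.
Import numFieldNormedType.Exports.
Local Open Scope classical_set_scope.
Local Open Scope ring_scope.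

(* Vectors are columns.  The norm that the library puts on matrices is the
   sup norm; it is used below only through the topology and the derivative. *)

Definition dotv (R : realType) (p : nat) (u v : 'cV[R]_p) : R :=
  (u^T *m v) 0 0.

Definition enorm (R : realType) (p : nat) (v : 'cV[R]_p) : R :=
  Num.sqrt (dotv v v).

(* The squared norm v^T W v. *)
Definition wnorm2 (R : realType) (p : nat) (W : 'M[R]_p) (v : 'cV[R]_p) : R :=
  dotv v (W *m v).

Definition spd (R : realType) (p : nat) (A : 'M[R]_p) : Prop :=
  A^T = A /\ forall v : 'cV[R]_p, v != 0 -> 0 < dotv v (A *m v).

(* The library's jacobian acts on row vectors, from the right; this is the
   usual matrix of partial derivatives for maps between column vectors. *)
Definition jac (R : realType) (p q : nat) (f : 'cV[R]_p -> 'cV[R]_q)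
    (x : 'cV[R]_p) : 'M[R]_(q, p) :=
  \matrix_(i, j) ('D_(delta_mx j 0 : 'cV[R]_p) f x) i 0.

Definition cont_diff (R : realType) (p q : nat) (f : 'cV[R]_p -> 'cV[R]_q)
    : Prop :=
  (forall x, differentiable f x) /\ continuous (jac f).

Definition grad (R : realType) (p : nat) (f : 'cV[R]_p -> R) (x : 'cV[R]_p)
    : 'cV[R]_p :=
  \col_i 'D_(delta_mx i 0 : 'cV[R]_p) f x.

Definition hess (R : realType) (p : nat) (f : 'cV[R]_p -> R) (x : 'cV[R]_p)
    : 'M[R]_p :=
  jac (grad f) x.

Definition opnorm (R : realType) (p q : nat) (A : 'M[R]_(q, p)) : R :=
  sup [set enorm (A *m v) | v in [set v : 'cV[R]_p | enorm v <= 1]].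

Definition condnum (R : realType) (p : nat) (A : 'M[R]_p) : R :=
  opnorm A * opnorm (invmx A).

(* Index conventions: observation times 0, ..., N are the elements of
   'I_N.+1; a family indexed by 1, ..., N is indexed here by 'I_N, its j-th
   member (j < N) being the one numbered j + 1. *)
Record wc4dvar (R : realType) (N n : nat) (m : 'I_N.+1 -> nat) := WC4DVar {
  bgd : 'cV[R]_n;
  obs : forall j : 'I_N.+1, 'cV[R]_(m j);
  obsop : forall j : 'I_N.+1, 'cV[R]_n -> 'cV[R]_(m j);
  model : 'I_N -> 'cV[R]_n -> 'cV[R]_n;
  bgcov : 'M[R]_n;
  modcov : 'I_N -> 'M[R]_n;
  obscov : forall j : 'I_N.+1, 'M[R]_(m j)
}.

Definition wc4dvar_regular (R : realType) (N n : nat) (m : 'I_N.+1 -> nat)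
    (P : wc4dvar R n m) : Prop :=
  [/\ forall j, cont_diff (obsop P j),
      forall j, cont_diff (model P j),
      spd (bgcov P),
      forall j, spd (modcov P j)
    & forall j, spd (obscov P j)].

(* n (N + 1), in the form required by the block matrices of the library. *)
Notation sdim N n := (\sum_(i < N.+1) n)%N.

Section WC4DVar.
Variables (R : realType) (N n : nat) (m : 'I_N.+1 -> nat).
Variable P : wc4dvar R n m.

Notation state := ('cV[R]_(sdim N n)).
Notation odim := (\sum_(i < N.+1) m i)%N.

Definition blk (x : state) (j : 'I_N.+1) : 'cV[R]_n :=
  submxcol (p_ := fun _ : 'I_N.+1 => n) x j.

(* For j < N: the blocks numbered j and j + 1. *)
Definition blk_pred (x : state) (j : 'I_N) : 'cV[R]_n :=
  blk x (widen_ord (leqnSn N) j).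
Definition blk_succ (x : state) (j : 'I_N) : 'cV[R]_n :=
  blk x (lift ord0 j).

Definition objJ (x : state) : R :=
    2^-1 * wnorm2 (invmx (bgcov P)) (blk x ord0 - bgd P)
  + 2^-1 * (\sum_(j < N.+1)
      wnorm2 (invmx (obscov P j)) (obsop P j (blk x j) - obs P j))
  + 2^-1 * (\sum_(j < N)
      wnorm2 (invmx (modcov P j)) (blk_succ x j - model P j (blk_pred x j))).

(* [unlift ord0 i] is [Some j] when i = j + 1, and [None] when i = 0. *)
Definition Lmx (xk : state) : 'M[R]_(sdim N n) :=
  \mxblock_(i < N.+1, j < N.+1)
    (if i == j then 1%:M
     else if unlift ord0 i is Some l then
       if j == l :> nat then - jac (model P l) (blk_pred xk l) else 0
     else 0 : 'M[R]_n).

Definition Hmx (xk : state) : 'M[R]_(odim, sdim N n) :=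
  \mxblock_(i < N.+1, j < N.+1)
    (if i == j then jac (obsop P i) (blk xk i)
     else 0 : 'M[R]_(m i, n)).

Definition Dmx : 'M[R]_(sdim N n) :=
  \mxdiag_(i < N.+1)
    (if unlift ord0 i is Some l then modcov P l else bgcov P).

Definition Rmx : 'M[R]_odim := \mxdiag_(i < N.+1) obscov P i.

Definition bvec (xk : state) : state :=
  \mxcol_(i < N.+1)
    (if unlift ord0 i is Some l
     then model P l (blk_pred xk l) - blk_succ xk l
     else bgd P - blk xk ord0).

Definition dvec (xk : state) : 'cV[R]_odim :=
  \mxcol_(i < N.+1) (obs P i - obsop P i (blk xk i)).

Definition qmodel (xk dx : state) : R :=
    2^-1 * wnorm2 (invmx Dmx) (Lmx xk *m dx - bvec xk)
  + 2^-1 * wnorm2 (invmx Rmx) (Hmx xk *m dx - dvec xk).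

Definition saddle_solution (xk : state) (dl : state) (dm : 'cV[R]_odim)
    (dx : state) : Prop :=
  block_mx (block_mx Dmx 0 0 Rmx) (col_mx (Lmx xk) (Hmx xk))
           (row_mx (Lmx xk)^T (Hmx xk)^T) 0
    *m col_mx (col_mx dl dm) dx
  = col_mx (col_mx (bvec xk) (dvec xk)) 0.

(* The inner solver enters only through its final inner iteration number j and
   the triple (dl, dm, dx) that it returns there: the test below is the only
   property of that triple which is used. *)
Definition inner_stop (epsq : R) (theta : nat -> R) (xk : state) (j : nat)
    (dl : state) (dm : 'cV[R]_odim) (dx : state) : Prop :=
  Num.max (epsq * Num.min 1 (enorm (grad objJ xk) ^+ 2)) (theta j)
    <= qmodel xk 0 - qmodel xk dx
  \/ saddle_solution xk dl dm dx.

Definition armijo (c : R) (xk dx : state) (a : R) : bool :=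
  objJ (xk + a *: dx) <= objJ xk + c * a * dotv (grad objJ xk) dx.

Definition backtracking_step (abar rho c : R) (xk dx : state) (a : R) : Prop :=
  exists i : nat,
    [/\ a = rho ^+ i * abar, armijo c xk dx a
      & forall l : nat, (l < i)%N -> ~~ armijo c xk dx (rho ^+ l * abar)].

Definition saddle_run (epsq : R) (theta : nat -> R) (abar rho c : R)
    (x dx : nat -> state) (alpha : nat -> R) : Prop :=
  forall k : nat,
    [/\ exists (j : nat) (dl : state) (dm : 'cV[R]_odim),
          (1 <= j)%N /\ inner_stop epsq theta (x k) j dl dm (dx k),
        backtracking_step abar rho c (x k) (dx k) (alpha k)
      & x k.+1 = x k + alpha k *: dx k].

End WC4DVar.

(* Main.v *)
Require Import Defs.
From mathcomp Require Import all_boot all_order all_algebra.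
From mathcomp Require Import all_classical all_reals all_analysis.
From mathcomp Require Import ring lra.

Set Implicit Arguments.
Unset Strict Implicit.
Unset Printing Implicit Defensive.

Import Order.TTheory GRing.Theory Num.Theory.
Import numFieldNormedType.Exports.
Local Open Scope classical_set_scope.
Local Open Scope ring_scope.

(* The background term bounds the first block of x and each model-error term
   bounds a block in terms of the previous one, so the sublevel sets of J are
   compact.  On such a set the Gauss-Newton Hessian
   A = L^T D^-1 L + H^T R^-1 H is continuous and positive definite (L is block
   unitriangular), hence a |v|^2 <= v^T A v and |A v|^2 <= b |v|^2 uniformly,
   and |g| is bounded.  Both exits of the inner solver then give
   gradient-related steps: the model decrease is -g^T dx - dx^T A dx / 2, and
   an exact saddle solution satisfies A dx = -g.  The line search therefore
   keeps the iterates in the initial sublevel set.  By uniform continuity of g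
   there, wherever |g| >= eps the Armijo test holds for all steps below a fixed
   threshold; so J would decrease by a fixed amount at each iterate with
   |g_k| >= eps, which happens only finitely often since J >= 0. *)

(** * Euclidean inner product and norm on columns *)

Section EuclideanColumns.
Variable R : realType.
Implicit Types (p q : nat).

Lemma dotvE p (u v : 'cV[R]_p) : dotv u v = \sum_i u i 0 * v i 0.
Proof. by rewrite /dotv mxE; apply: eq_bigr => i _; rewrite mxE. Qed.

Lemma dotvC p (u v : 'cV[R]_p) : dotv u v = dotv v u.
Proof. by rewrite !dotvE; apply: eq_bigr => i _; rewrite mulrC. Qed.

Lemma dotvDl p (u v w : 'cV[R]_p) : dotv (u + v) w = dotv u w + dotv v w.
Proof. by rewrite /dotv linearD mulmxDl mxE. Qed.

Lemma dotvDr p (u v w : 'cV[R]_p) : dotv w (u + v) = dotv w u + dotv w v.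
Proof. by rewrite /dotv mulmxDr mxE. Qed.

Lemma dotvNl p (u v : 'cV[R]_p) : dotv (- u) v = - dotv u v.
Proof. by rewrite /dotv linearN mulNmx mxE. Qed.

Lemma dotvNr p (u v : 'cV[R]_p) : dotv u (- v) = - dotv u v.
Proof. by rewrite /dotv mulmxN mxE. Qed.

Lemma dotvZl p a (u v : 'cV[R]_p) : dotv (a *: u) v = a * dotv u v.
Proof. by rewrite /dotv linearZ -scalemxAl mxE. Qed.

Lemma dotvZr p a (u v : 'cV[R]_p) : dotv u (a *: v) = a * dotv u v.
Proof. by rewrite dotvC dotvZl dotvC. Qed.

Lemma dotv_mulmxl p q (A : 'M[R]_(q, p)) u v :
  dotv (A *m u) v = dotv u (A^T *m v).
Proof. by rewrite /dotv trmx_mul mulmxA. Qed.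

Lemma dotv_deltar p (u : 'cV[R]_p) i : dotv u (delta_mx i 0) = u i 0.
Proof.
rewrite dotvE (bigD1 i) //= !mxE !eqxx mulr1 big1 ?addr0 // => j /negPf ji.
by rewrite !mxE ji mulr0.
Qed.

Lemma dotvv_ge0 p (u : 'cV[R]_p) : 0 <= dotv u u.
Proof. by rewrite dotvE sumr_ge0 // => i _; rewrite -expr2 sqr_ge0. Qed.

Lemma coord_sqr_le p (u : 'cV[R]_p) i : u i 0 ^+ 2 <= dotv u u.
Proof.
rewrite dotvE (bigD1 i) //= expr2 lerDl sumr_ge0 // => j _.
by rewrite -expr2 sqr_ge0.
Qed.

Lemma dotvv_eq0 p (u : 'cV[R]_p) : (dotv u u == 0) = (u == 0).
Proof.
apply/eqP/eqP => [u0|->]; last by rewrite /dotv mulmx0 mxE.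
apply/colP => i; rewrite mxE; apply/eqP; rewrite -sqrf_eq0 eq_le sqr_ge0 andbT.
by rewrite -u0 coord_sqr_le.
Qed.

Lemma dotvv_gt0 p (u : 'cV[R]_p) : (0 < dotv u u) = (u != 0).
Proof. by rewrite lt_def dotvv_ge0 andbT dotvv_eq0. Qed.

Lemma enorm_ge0 p (u : 'cV[R]_p) : 0 <= enorm u.
Proof. exact: sqrtr_ge0. Qed.

Lemma enorm_sqr p (u : 'cV[R]_p) : enorm u ^+ 2 = dotv u u.
Proof. by rewrite sqr_sqrtr ?dotvv_ge0. Qed.

Lemma enormZ p a (u : 'cV[R]_p) : enorm (a *: u) = `|a| * enorm u.
Proof.
by rewrite /enorm dotvZl dotvZr mulrA -expr2 sqrtrM ?sqr_ge0 // sqrtr_sqr.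
Qed.

(** Cauchy-Schwarz: the squared length of [dotv v v *: u - dotv u v *: v] is nonnegative and equals
    [dotv v v] times the gap between the squares of the two sides. *)
Lemma dotv_le_enorm p (u v : 'cV[R]_p) : dotv u v <= enorm u * enorm v.
Proof.
have [->|v0] := eqVneq v 0.
  by rewrite {1}/dotv mulmx0 mxE mulr_ge0 ?enorm_ge0.
have V0 : 0 < dotv v v by rewrite dotvv_gt0.
have := dotvv_ge0 (dotv v v *: u - dotv u v *: v).
rewrite !(dotvDl, dotvDr, dotvNl, dotvNr, dotvZl, dotvZr) (dotvC v u) => h.
apply: (le_trans (ler_norm _)).
rewrite -(@ler_pXn2r _ 2) ?nnegrE ?mulr_ge0 ?enorm_ge0 //.
rewrite real_normK ?num_real // exprMn !enorm_sqr.
by rewrite -(ler_pM2l V0); nra.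
Qed.

Lemma normr_le_enorm p (u : 'cV[R]_p) : `|u| <= enorm u.
Proof.
rewrite [leLHS]/Num.Def.normr /= mx_normrE bigmax_le ?enorm_ge0 // => -[i j] _.
rewrite (ord1 j) /= -(@ler_pXn2r _ 2) ?nnegrE ?enorm_ge0 //.
by rewrite real_normK ?num_real // enorm_sqr coord_sqr_le.
Qed.

Lemma mx_entry_le_norm p q (A : 'M[R]_(p, q)) i j : `|A i j| <= `|A|.
Proof.
by rewrite [leRHS]/Num.Def.normr /= mx_normrE; exact: (le_bigmax _ _ (i, j)).
Qed.

(** * Weighted norms, positive-definite and block diagonal matrices *)

Lemma wnorm2N p (W : 'M[R]_p) v : wnorm2 W (- v) = wnorm2 W v.
Proof. by rewrite /wnorm2 mulmxN dotvNl dotvNr opprK. Qed.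

Lemma spd_ge0 p (W : 'M[R]_p) v : spd W -> 0 <= wnorm2 W v.
Proof.
case=> _ Wpos; have [->|v0] := eqVneq v 0; last exact/ltW/Wpos.
by rewrite /wnorm2 /dotv !mulmx0 mxE.
Qed.

(** By symmetry, the transpose of a row of the left kernel lies in the right kernel; if it were
    nonzero, the quadratic form would vanish there. *)
Lemma spd_unitmx p (W : 'M[R]_p) : spd W -> W \in unitmx.
Proof.
case=> Wsym Wpos; rewrite -row_free_unit -kermx_eq0; apply/eqP/row_matrixP => i.
rewrite row0; apply: trmx_inj; rewrite trmx0; apply/eqP/negP => /negP v0.
have := Wpos _ v0; rewrite -[X in X *m _]Wsym -trmx_mul -row_mul mulmx_ker.
by rewrite row0 trmx0 /dotv mulmx0 mxE ltxx.
Qed.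

(** With [u = invmx W *m v], the form of the inverse at [v] is the form of [W] at [u]. *)
Lemma spd_invmx p (W : 'M[R]_p) : spd W -> spd (invmx W).
Proof.
move=> Wspd; have Wu := spd_unitmx Wspd; case: Wspd => Wsym Wpos; split.
  by rewrite trmx_inv Wsym.
move=> v v0; have u0 : invmx W *m v != 0.
  by apply: contra v0 => /eqP h; rewrite -(mulKVmx Wu v) h mulmx0.
by have := Wpos _ u0; rewrite mulKVmx // dotvC.
Qed.

Lemma dotv_mxcol k (p_ : 'I_k -> nat) (U V : forall i, 'cV[R]_(p_ i)) :
  dotv (\mxcol_i U i) (\mxcol_i V i) = \sum_i dotv (U i) (V i).
Proof. by rewrite /dotv tr_mxcol mul_mxrow_mxcol summxE. Qed.

Lemma wnorm2_mxdiag k (p_ : 'I_k -> nat) (W : forall i, 'M[R]_(p_ i))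
    (V : forall i, 'cV[R]_(p_ i)) :
  wnorm2 (\mxdiag_i W i) (\mxcol_i V i) = \sum_i wnorm2 (W i) (V i).
Proof. by rewrite /wnorm2 mul_mxdiag_mxcol dotv_mxcol. Qed.

Lemma spd_mxdiag k (p_ : 'I_k -> nat) (W : forall i, 'M[R]_(p_ i)) :
  (forall i, spd (W i)) -> spd (\mxdiag_i W i).
Proof.
move=> Wspd; split.
  by rewrite tr_mxdiag; apply: eq_mxdiag => i; case: (Wspd i).
move=> v; rewrite -[v]submxcolK => v0; rewrite -/(wnorm2 _ _) wnorm2_mxdiag.
rewrite lt_def sumr_ge0 ?andbT => [|i _]; last exact: spd_ge0.
apply: contra v0; rewrite psumr_eq0 => [/allP h|i _]; last exact: spd_ge0.
apply/eqP/mxcolP => i; rewrite mxcolK submxcol0; apply/eqP/negP => /negP vi0.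
have := h i (mem_index_enum _); rewrite /= gt_eqF //.
by case: (Wspd i) => _; apply.
Qed.

Lemma invmx_mxdiag k (p_ : 'I_k -> nat) (W : forall i, 'M[R]_(p_ i)) :
  (forall i, W i \in unitmx) ->
  invmx (\mxdiag_i W i) = \mxdiag_i invmx (W i).
Proof.
move=> Wu; have E : (\mxdiag_i W i) *m (\mxdiag_i invmx (W i)) = 1%:M.
  rewrite -[RHS]mxdiagZ {2}/mxdiag mul_mxdiag_mxblock /mxdiag.
  apply: eq_mxblock => i j; case: eqVneq => [ij|]; last by rewrite mulmx0.
  (* The size of a block depends on its index, so a diagonal block is stored through a cast;
     eliminating the equality of indices makes the cast trivial. *)
  by case: _ / ij; rewrite !conform_mx_id mulmxV.
have [Du _] := mulmx1_unit E.
by rewrite -[LHS]mulmx1 -E mulKmx.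
Qed.

End EuclideanColumns.

(** * Limits and directional derivatives of matrix-valued maps *)

Section MatrixCalculus.
Variable R : realType.

(** The norm is a maximum over finitely many entries, so the entrywise conditions can be met
    simultaneously. Limits of products, transposes and block matrices all reduce to this. *)
Lemma cvg_mxP (T : Type) (F : set_system T) {FF : Filter F} p q
    (f : T -> 'M[R]_(p, q)) (l : 'M[R]_(p, q)) :
  (f t @[t --> F] --> l) <-> forall i j, f t i j @[t --> F] --> l i j.
Proof.
split=> [fl i j|fl].
  exact: (cvg_comp f (fun M : 'M[R]_(p, q) => M i j) fl
    (@coord_continuous _ _ _ i j l)).
apply/cvgrPdist_le => e e0; near=> t.
rewrite /Num.Def.normr /= mx_normrE (bigmax_le _ (ltW e0)) //= => -[i j] _.
rewrite !mxE /=.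
suff: forall k : 'I_p * 'I_q, `|l k.1 k.2 - f t k.1 k.2| <= e by move/(_ (i, j)).
near: t; apply: filter_forall => -[a b].
by have /cvgrPdist_le/(_ _ e0) := fl a b.
Unshelve. all: by end_near. Qed.

Lemma cvg_mulmx (T : Type) (F : set_system T) {FF : Filter F} p q r
    (f : T -> 'M[R]_(p, q)) (g : T -> 'M[R]_(q, r))
    (l : 'M[R]_(p, q)) (k : 'M[R]_(q, r)) :
  f t @[t --> F] --> l -> g t @[t --> F] --> k ->
  f t *m g t @[t --> F] --> l *m k.
Proof.
move=> /cvg_mxP fl /cvg_mxP gk; apply/cvg_mxP => i j.
rewrite mxE; under eq_cvg do rewrite mxE.
by apply: cvg_big => [|a _]; [exact: add_continuous | exact: cvgM].
Qed.

Lemma cvg_trmx (T : Type) (F : set_system T) {FF : Filter F} p q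
    (f : T -> 'M[R]_(p, q)) (l : 'M[R]_(p, q)) :
  f t @[t --> F] --> l -> (f t)^T @[t --> F] --> l^T.
Proof.
move=> /cvg_mxP fl; apply/cvg_mxP => i j.
by rewrite mxE; under eq_cvg do rewrite mxE; exact: fl.
Qed.

Lemma cvg_dotv (T : Type) (F : set_system T) {FF : Filter F} p
    (f g : T -> 'cV[R]_p) (l k : 'cV[R]_p) :
  f t @[t --> F] --> l -> g t @[t --> F] --> k ->
  dotv (f t) (g t) @[t --> F] --> dotv l k.
Proof.
move=> fl gk.
have /cvg_mxP/(_ 0 0) // : (f t)^T *m g t @[t --> F] --> l^T *m k.
by apply: cvg_mulmx => //; exact: cvg_trmx.
Qed.

Lemma cvg_enorm (T : Type) (F : set_system T) {FF : Filter F} p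
    (f : T -> 'cV[R]_p) (l : 'cV[R]_p) :
  f t @[t --> F] --> l -> enorm (f t) @[t --> F] --> enorm l.
Proof.
move=> fl; apply: (cvg_comp _ _ (cvg_dotv fl fl)); exact: sqrt_continuous.
Qed.

Lemma cvg_mxcol (T : Type) (F : set_system T) {FF : Filter F} k
    (p_ : 'I_k -> nat) r (f : T -> forall i, 'M[R]_(p_ i, r))
    (l : forall i, 'M[R]_(p_ i, r)) :
  (forall i, f t i @[t --> F] --> l i) ->
  \mxcol_i f t i @[t --> F] --> \mxcol_i l i.
Proof.
move=> fl; apply/cvg_mxP => i j.
rewrite mxE; under eq_cvg do rewrite mxE.
by have /cvg_mxP := fl (tagnat.sig1 i); exact.
Qed.

Lemma cvg_mxblock (T : Type) (F : set_system T) {FF : Filter F} k l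
    (p_ : 'I_k -> nat) (q_ : 'I_l -> nat)
    (f : T -> forall i j, 'M[R]_(p_ i, q_ j))
    (L : forall i j, 'M[R]_(p_ i, q_ j)) :
  (forall i j, f t i j @[t --> F] --> L i j) ->
  \mxblock_(i, j) f t i j @[t --> F] --> \mxblock_(i, j) L i j.
Proof.
move=> fl; apply/cvg_mxP => i j.
rewrite mxE; under eq_cvg do rewrite mxE.
by have /cvg_mxP := fl (tagnat.sig1 i) (tagnat.sig1 j); exact.
Qed.

Lemma is_derive_mxP (V : normedModType R) p q (M : V -> 'M[R]_(p, q)) dM x v :
  is_derive x v M dM <->
  forall i j, is_derive x v (fun y => M y i j) (dM i j).
Proof.
split=> [[Md <-] i j|Md].
  have Mij := (derivable_mxP _ _ _).1 Md.
  by apply: DeriveDef => //; rewrite derive_mx // mxE.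
have dM1 : derivable M x v by apply/derivable_mxP => i j; case: (Md i j).
apply: DeriveDef => //; rewrite derive_mx //.
by apply/matrixP => i j; rewrite mxE; case: (Md i j).
Qed.

Lemma is_derive_mulmx (V : normedModType R) p q r (f : V -> 'M[R]_(p, q))
    (g : V -> 'M[R]_(q, r)) df dg x v :
  is_derive x v f df -> is_derive x v g dg ->
  is_derive x v (fun y => f y *m g y) (df *m g x + f x *m dg).
Proof.
move=> /is_derive_mxP fd /is_derive_mxP gd; apply/is_derive_mxP => i j.
have -> : (fun y => (f y *m g y) i j) =
    \sum_a ((fun y => f y i a) * (fun y => g y a j)).
  by apply/funext => y; rewrite fct_sumE mxE.
apply: is_derive_eq; rewrite !mxE -big_split /=; apply: eq_bigr => a _.
by rewrite addrC; congr (_ + _); exact: mulrC.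
Qed.

Lemma is_derive_trmx (V : normedModType R) p q (f : V -> 'M[R]_(p, q)) df x v :
  is_derive x v f df -> is_derive x v (fun y => (f y)^T) df^T.
Proof.
move=> /is_derive_mxP fd; apply/is_derive_mxP => i j; rewrite mxE.
by under [X in is_derive _ _ X]funext do rewrite mxE; exact: fd.
Qed.

(** The product rule gives two terms, which coincide by symmetry of [W]; hence the factor 2. *)
Lemma is_derive_wnorm2 (V : normedModType R) p (W : 'M[R]_p)
    (f : V -> 'cV[R]_p) df x v : W^T = W ->
  is_derive x v f df ->
  is_derive x v (fun y => wnorm2 W (f y)) (2 * dotv (W *m f x) df).
Proof.
move=> Wsym fd.
have cd : is_derive x v (fun=> W) 0 by exact: is_derive_cst.
have /is_derive_mxP/(_ 0 0) :=
  is_derive_mulmx (is_derive_trmx fd) (is_derive_mulmx cd fd).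
rewrite [X in is_derive _ _ _ X](_ : _ = 2 * dotv (W *m f x) df) //.
rewrite mul0mx add0r mxE -!/(dotv _ _) (dotvC df) dotv_mulmxl Wsym.
by ring.
Qed.

Lemma is_derive_mxcol (V : normedModType R) k (p_ : 'I_k -> nat) r
    (f : V -> forall i, 'M[R]_(p_ i, r)) df x v :
  (forall i, is_derive x v (fun y => f y i) (df i)) ->
  is_derive x v (fun y => \mxcol_i f y i) (\mxcol_i df i).
Proof.
move=> fd; apply/is_derive_mxP => i j; rewrite mxE.
under [X in is_derive _ _ X]funext do rewrite mxE.
by have /is_derive_mxP := fd (tagnat.sig1 i); exact.
Qed.

(** The difference quotient of [f \o B] along [v] is literally that of [f] along [B v]. It serves to
    differentiate functions of a single block of the state. *)
Lemma is_derive_comp_linear (U V W : normedModType R) (B : U -> V)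
    (f : V -> W) df x v :
  linear B -> is_derive (B x) (B v) f df -> is_derive x v (f \o B) df.
Proof.
move=> Blin [fd fE].
have E : (fun h : R => h^-1 *: (((f \o B) \o shift x) (h *: v) - (f \o B) x)) =
         (fun h : R => h^-1 *: ((f \o shift (B x)) (h *: B v) - f (B x))).
  by apply/funext => h /=; rewrite Blin.
by apply: DeriveDef; [rewrite /derivable E | rewrite -fE /derive E].
Qed.

Lemma colE_delta p (v : 'cV[R]_p) : v = \sum_i v i 0 *: delta_mx i 0.
Proof.
apply/colP => i; rewrite summxE (bigD1 i) //= !mxE !eqxx mulr1 big1 ?addr0 //.
by move=> j /negPf ji; rewrite !mxE eq_sym ji mulr0.
Qed.

(** [jac] is made of partial derivatives; differentiability makes the directional derivative linear
    in [v], so expanding [v] in the canonical basis recovers it. *)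
Lemma is_derive_jac p q (f : 'cV[R]_p -> 'cV[R]_q) x v :
  differentiable f x -> is_derive x v f (jac f x *m v).
Proof.
move=> fd; apply: DeriveDef; first exact: diff_derivable.
rewrite deriveE // {1}(colE_delta v) linear_sum; apply/colP => i.
rewrite summxE mxE; apply: eq_bigr => j _.
by rewrite linearZ !mxE deriveE // mulrC.
Qed.

Lemma grad_is_derive p (f : 'cV[R]_p -> R) (g : 'cV[R]_p) x :
  (forall v, is_derive x v f (dotv g v)) -> grad f x = g.
Proof.
move=> fd; apply/colP => i; rewrite mxE.
by case: (fd (delta_mx i 0)) => _ ->; rewrite dotv_deltar.
Qed.

(** Heine-Borel for row vectors, carried over to columns by transposition, which is continuous and
    only permutes entries. *)
Lemma bounded_closed_compact_col p (A : set 'cV[R]_p) :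
  bounded_set A -> closed A -> compact A.
Proof.
move=> Abd Acl.
have ctr a b : continuous (@trmx R a b) by
  move=> u; exact: (@cvg_trmx _ (nbhs u) _ _ _ id u).
have -> : A = trmx @` (trmx @^-1` A : set 'rV[R]_p).
  rewrite predeqE => u; split=> [Au|[w Aw <-] //].
  by exists u^T; rewrite /= ?trmxK.
apply: continuous_compact; first by apply: continuous_subspaceT; exact: ctr.
apply: bounded_closed_compact; last by apply: preimage_closed => // u _; exact: ctr.
move: Abd => [M [Mr AM]]; exists M; split=> // y My w /= Aw.
rewrite [leLHS]/Num.Def.normr /= mx_normrE bigmax_le //.
  by apply: le_trans (AM _ My _ Aw).
move=> -[i j] _ /=; rewrite (le_trans _ (AM _ My _ Aw)) //.
have -> : w i j = w^T j i by rewrite mxE.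
exact: mx_entry_le_norm.
Qed.

End MatrixCalculus.

(** * Uniform bounds over compact sets *)

Section CompactBounds.
Variable R : realType.

(** The bound is made positive, by a maximum with 1, so that it can later be a denominator. *)
Lemma compact_ubound (T : topologicalType) (K : set T) (f : T -> R) :
  compact K -> continuous f -> exists2 b, 0 < b & forall t, K t -> f t <= b.
Proof.
move=> cK cf; have [->|/set0P K0] := eqVneq K set0; first by exists 1.
have [c _ fc] := compact_EVT_max K0 cK (continuous_subspaceT cf).
exists (Num.max 1 (f c)) => [|t Kt]; first by rewrite lt_max ltr01.
by rewrite le_max fc ?orbT ?inE.
Qed.

Lemma compact_pos_lbound (T : topologicalType) (K : set T) (f : T -> R) :
  compact K -> continuous f -> (forall t, K t -> 0 < f t) ->
  exists2 a, 0 < a & forall t, K t -> a <= f t.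
Proof.
move=> cK cf fpos; have [->|/set0P K0] := eqVneq K set0; first by exists 1.
have [c Kc fc] := compact_EVT_min K0 cK (continuous_subspaceT cf).
exists (f c) => [|t Kt]; first by apply: fpos; rewrite inE in Kc.
by rewrite fc ?inE.
Qed.

Lemma compact_sphere p : compact [set v : 'cV[R]_p | enorm v = 1].
Proof.
apply: bounded_closed_compact_col.
  exists 1; split; first exact: num_real.
  by move=> y y1 v /= v1; rewrite (le_trans (normr_le_enorm v)) // v1 ltW.
apply: (@preimage_closed _ _ (@enorm R p) [set 1]).
  by move=> u _; exact: (@cvg_enorm _ _ (nbhs u) _ _ id u).
exact: closed_eq.
Qed.

(** By homogeneity, the Rayleigh quotient is a continuous function on the compact product of [K]
    with the unit sphere, so the extreme value theorem yields constants uniform in [t]. *)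
Lemma quad_form_bounds (T : topologicalType) (K : set T) p (F : T -> 'M[R]_p) :
  compact K -> continuous F ->
  (exists2 b, 0 < b & forall t v, K t -> dotv v (F t *m v) <= b * dotv v v) /\
  ((forall t v, K t -> v != 0 -> 0 < dotv v (F t *m v)) ->
   exists2 a, 0 < a & forall t v, K t -> a * dotv v v <= dotv v (F t *m v)).
Proof.
move=> cK cF.
pose S := K `*` [set v : 'cV[R]_p | enorm v = 1].
pose f (tv : T * 'cV[R]_p) := dotv tv.2 (F tv.1 *m tv.2).
have cS : compact S by apply: compact_setX => //; exact: compact_sphere.
have cf : continuous f.
  move=> [t v]; apply: cvg_dotv; first exact: cvg_snd.
  apply: cvg_mulmx; last exact: cvg_snd.
  by apply: cvg_comp; [exact: cvg_fst | exact: cF].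
have normalized t v : K t -> v != 0 -> S (t, (enorm v)^-1 *: v) /\
    f (t, (enorm v)^-1 *: v) = dotv v (F t *m v) / dotv v v.
  move=> Kt v0; have ev : 0 < enorm v.
    by rewrite lt_def enorm_ge0 andbT -sqrf_eq0 enorm_sqr dotvv_eq0.
  split; first split => //=.
    by rewrite enormZ ger0_norm ?invr_ge0 ?enorm_ge0 // mulVf ?gt_eqF.
  rewrite /f /= -scalemxAr dotvZl dotvZr -enorm_sqr expr2 invfM mulrA mulrC.
  by rewrite mulrA.
have dot0 t : dotv (0 : 'cV[R]_p) (F t *m 0) = 0.
  by rewrite mulmx0 /dotv mulmx0 mxE.
have dot00 : dotv (0 : 'cV[R]_p) 0 = 0 by rewrite /dotv mulmx0 mxE.
split.
  have [b b0 fb] := compact_ubound cS cf; exists b => // t v Kt.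
  have [->|v0] := eqVneq v 0; first by rewrite dot0 dot00 mulr0.
  have [/fb + fE] := normalized t v Kt v0.
  by rewrite fE ler_pdivrMr // dotvv_gt0.
move=> Fpos; have [|a a0 fa] := compact_pos_lbound cS cf.
  move=> [t v] [/= Kt v1]; apply: Fpos => //.
  by rewrite -dotvv_eq0 -enorm_sqr v1 expr1n oner_eq0.
exists a => // t v Kt.
have [->|v0] := eqVneq v 0; first by rewrite dot0 dot00 mulr0.
have [/fa + fE] := normalized t v Kt v0.
by rewrite fE ler_pdivlMr // dotvv_gt0.
Qed.

(** The previous bound for a constant family over a one-point set. *)
Lemma spd_lower_bound p (W : 'M[R]_p) : spd W ->
  exists2 a, 0 < a & forall v, a * dotv v v <= wnorm2 W v.
Proof.
move=> [_ Wpos].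
have cW : continuous (fun _ : R => W) by move=> ?; exact: cvg_cst.
have [_ /(_ _)[|a a0 h]] := quad_form_bounds (@compact_set1 R 0) cW.
  by move=> t v _; exact: Wpos.
by exists a => // v; exact: h.
Qed.

End CompactBounds.

(** * Gradient-related steps on a compact set *)

Section Descent.
Variables (R : realType) (p : nat) (J : 'cV[R]_p -> R).
Variables (g : 'cV[R]_p -> 'cV[R]_p) (K : set 'cV[R]_p).
Hypotheses (cK : compact K) (cg : continuous g).
Implicit Types x d : 'cV[R]_p.

Lemma gradient_bounded_on_compact :
  exists2 G, 0 < G & forall x, K x -> dotv (g x) (g x) <= G.
Proof.
apply: (compact_ubound (f := fun x => dotv (g x) (g x))) => //.
by move=> x; exact: (cvg_dotv (@cg x) (@cg x)).
Qed.

(** In both cases [- dotv (g x) d] is at least half of the form of [A x] at [d], which controls [d].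
    The descent bound comes from the required model decrease in the first case, and from
    [g x = - (A x *m d)] in the second. *)
Lemma gauss_newton_gradient_related (A : 'cV[R]_p -> 'M[R]_p) (eps : R) :
  continuous A -> (forall x v, K x -> v != 0 -> 0 < dotv v (A x *m v)) ->
  0 < eps ->
  exists kappa1 kappa2, [/\ 0 < kappa1, kappa1 <= kappa2 &
    forall x d, K x ->
      eps * Num.min 1 (enorm (g x) ^+ 2)
        <= - dotv (g x) d - 2^-1 * dotv d (A x *m d) \/ A x *m d = - g x ->
      dotv (g x) d <= - kappa1 * enorm (g x) ^+ 2 /\
      enorm d <= kappa2 * enorm (g x)].
Proof.
move=> cA Apos eps0.
have [_ /(_ Apos)[a a0 aA]] := quad_form_bounds cK cA.
have cAA : continuous (fun x => (A x)^T *m A x).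
  by move=> x; exact: (cvg_mulmx (cvg_trmx (cA x)) (cA x)).
have [[b b0 bA] _] := quad_form_bounds cK cAA.
have [G G0 gG] := gradient_bounded_on_compact.
(* One entry for each case: if [0 <= s <= G] then [s / (1 + G) <= Num.min 1 s]; and if
   [A x *m d = - g x] then [dotv (g x) (g x) <= b * dotv d d], while
   [a * dotv d d <= - dotv (g x) d]. *)
pose k1 := Num.min (eps / (1 + G)) (a / b).
have k10 : 0 < k1 by rewrite lt_min !divr_gt0 // addr_gt0.
exists k1, (Num.max k1 (2 / a)); split=> //; first by rewrite le_max lexx.
move=> x d Kx step.
have dAd := aA x d Kx.
have dd0 := dotvv_ge0 d.
have gg0 := dotvv_ge0 (g x).
have add0 : 0 <= a * dotv d d by rewrite mulr_ge0 // ltW.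
have [gd ad] : dotv (g x) d <= - k1 * enorm (g x) ^+ 2 /\
               a / 2 * dotv d d <= - dotv (g x) d.
  rewrite enorm_sqr in step *; case: step => [step|Ad].
    have m0 : 0 <= eps * Num.min 1 (dotv (g x) (g x)).
      by rewrite mulr_ge0 ?(ltW eps0) // le_min ler01.
    have mG : eps / (1 + G) * dotv (g x) (g x)
              <= eps * Num.min 1 (dotv (g x) (g x)).
      rewrite -mulrA ler_pM2l // mulrC le_min.
      rewrite !ler_pdivrMr ?addr_gt0 // mul1r mulrDr mulr1 lerDl.
      by rewrite mulr_ge0 ?(ltW G0) // andbT (le_trans (gG _ Kx)) // lerDr.
    have k1G : k1 * dotv (g x) (g x) <= eps / (1 + G) * dotv (g x) (g x).
      by rewrite ler_wpM2r // ge_min lexx.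
    split; [rewrite mulNr|]; lra.
  have gE : g x = - (A x *m d) by rewrite Ad opprK.
  have gd : dotv (g x) d = - dotv d (A x *m d) by rewrite gE dotvNl dotvC.
  split; last by lra.
  have ggE : dotv (g x) (g x) <= b * dotv d d.
    by rewrite gE dotvNl dotvNr opprK dotv_mulmxl mulmxA bA.
  have k1b : k1 * dotv (g x) (g x) <= a / b * dotv (g x) (g x).
    by rewrite ler_wpM2r // ge_min lexx orbT.
  have abgg : a / b * dotv (g x) (g x) <= a * dotv d d.
    by rewrite mulrAC ler_pdivrMr // -mulrA ler_pM2l // mulrC.
  by rewrite mulNr; lra.
split=> //; have [->|d0] := eqVneq d 0.
  rewrite /enorm {1}/dotv mulmx0 mxE sqrtr0 mulr_ge0 ?sqrtr_ge0 //.
  by rewrite le_max (ltW k10).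
have ed : 0 < enorm d.
  by rewrite lt_def enorm_ge0 andbT -sqrf_eq0 enorm_sqr dotvv_eq0.
have cs : - dotv (g x) d <= enorm (g x) * enorm d.
  rewrite -dotvNr (le_trans (dotv_le_enorm _ _)) //.
  by rewrite -scaleN1r enormZ normrN1 mul1r.
(* Cauchy-Schwarz turns [ad] into [a / 2 * enorm d ^+ 2 <= enorm (g x) * enorm d]; one factor
   [enorm d] cancels. *)
have : enorm d <= 2 / a * enorm (g x).
  rewrite mulrAC ler_pdivlMr // mulrC -(ler_pM2r ed) -mulrA -expr2 enorm_sqr.
  by rewrite -mulrA; lra.
move=> /le_trans; apply; rewrite ler_wpM2r ?enorm_ge0 //.
by rewrite le_max lexx orbT.
Qed.

(** * Backtracking line search *)

Hypothesis dJ : forall x v, is_derive x v J (dotv (g x) v).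

Lemma mean_value_line x d t : 0 < t ->
  exists2 s, 0 < s < t & J (x + t *: d) - J x = dotv (g (x + s *: d)) d * t.
Proof.
move=> t0; pose f (s : R) := J (x + s *: d).
have df s : is_derive s (1 : R) f (dotv (g (x + s *: d)) d).
  have [Jd JE] := dJ (x + s *: d) d.
  have E : (fun h : R => h^-1 *: ((f \o shift s) (h *: 1) - f s)) =
      (fun h => h^-1 *: ((J \o shift (x + s *: d)) (h *: d) - J (x + s *: d))).
    apply/funext => h /=; rewrite /f; congr (_ *: (J _ - _)).
    by rewrite [h *: 1]mulr1 scalerDl addrCA.
  by apply: DeriveDef; [rewrite /derivable E | rewrite -JE /derive E].
have cf : continuous f.
  move=> s; apply: differentiable_continuous; apply/derivable1_diffP.
  by case: (df s).
have [s] := MVT t0 (fun s _ => df s) (continuous_subspaceT cf).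
rewrite in_itv /= => st; rewrite subr0 /f scale0r addr0 => fE.
by exists s.
Qed.

(** Only the base point [x] is confined to [K]; [x + w] may leave it. The covering form of
    compactness therefore works with joint neighbourhoods of [(x, 0)], and returns one neighbourhood
    of admissible [w] for all of [K]. *)
Lemma gradient_uniformly_continuous_near eta : 0 < eta ->
  exists2 delta, 0 < delta &
    forall x w, K x -> `|w| < delta -> enorm (g (x + w) - g x) < eta.
Proof.
move=> eta0.
pose Q (w x : 'cV[R]_p) := enorm (g (x + w) - g x) < eta.
have : \forall w \near (0 : 'cV[R]_p), K `<=` Q w.
  apply: ((compact_near_coveringP K).1 cK _ (nbhs (0 : 'cV[R]_p)) Q _) => x Kx.
  have cQ : enorm (g (y.1 + y.2) - g y.1) @[y --> (x, 0 : 'cV[R]_p)] --> (0 : R).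
    have -> : (0 : R) = enorm (g (x + 0) - g x).
      by rewrite addr0 subrr /enorm /dotv mulmx0 mxE sqrtr0.
    apply: cvg_enorm; apply: cvgB.
      apply: cvg_comp; last exact: cg.
      by apply: cvgD; [exact: cvg_fst | exact: cvg_snd].
    by apply: cvg_comp; [exact: cvg_fst | exact: cg].
  have /cvgr_lt/(_ _ eta0) := cQ.
  exact.
move=> /nbhs_normP[delta /= delta0 h]; exists delta => // x w Kx w0.
by apply: h => //=; rewrite sub0r normrN.
Qed.

(** The mean value theorem replaces the decrease by the slope at an intermediate point; if that
    slope differs from [dotv (g x) d] by at most [(1 - c) * - dotv (g x) d], the Armijo test
    holds. *)
Lemma armijo_uniform c kappa1 kappa2 eps :
  0 < c < 1 -> 0 < kappa1 -> 0 < kappa2 -> 0 < eps ->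
  exists2 tau, 0 < tau & forall x d t, K x ->
    dotv (g x) d <= - kappa1 * enorm (g x) ^+ 2 ->
    enorm d <= kappa2 * enorm (g x) -> eps <= enorm (g x) -> 0 < t <= tau ->
    J (x + t *: d) <= J x + c * t * dotv (g x) d.
Proof.
move=> /andP[c0 c1] k10 k20 eps0.
(* Chosen so that [eta * (kappa2 * enorm (g x))], which bounds the change of slope, is at most
   [(1 - c) * - dotv (g x) d] once [eps <= enorm (g x)]. *)
pose eta := (1 - c) * kappa1 * eps / kappa2.
have eta0 : 0 < eta by rewrite divr_gt0 // !mulr_gt0 // subr_gt0.
have [delta delta0 gdelta] := gradient_uniformly_continuous_near eta0.
have [G G0 gG] := gradient_bounded_on_compact.
have G10 : 0 < kappa2 * (1 + G) by rewrite mulr_gt0 // addr_gt0.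
(* Since [enorm d <= kappa2 * (1 + G)] on [K], shorter steps keep the displacement below [delta]. *)
exists (delta / (kappa2 * (1 + G))); first by rewrite divr_gt0.
move=> x d t Kx gd dg epsg /andP[t0 ttau].
have [s /andP[s0 st] JE] := mean_value_line x d t0.
have g0 := enorm_ge0 (g x).
have g1 : enorm (g x) <= 1 + G.
  have := gG _ Kx; rewrite -enorm_sqr => g2; nra.
have sd : `|s *: d| < delta.
  rewrite normrZ gtr0_norm // (le_lt_trans _ (_ : s * (kappa2 * (1 + G)) < _)) //.
    rewrite ler_pM2l // (le_trans (normr_le_enorm d)) // (le_trans dg) //.
    by rewrite ler_pM2l.
  by rewrite -ltr_pdivlMr // (lt_le_trans st).
have near_g := gdelta x _ Kx sd.
have -> : J (x + t *: d) = J x + dotv (g (x + s *: d)) d * t by rewrite -JE subrKC.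
rewrite lerD2l mulrAC ler_pM2r //.
have -> : dotv (g (x + s *: d)) d =
    dotv (g x) d + dotv (g (x + s *: d) - g x) d.
  by rewrite dotvDl dotvNl subrKC.
have cs : dotv (g (x + s *: d) - g x) d <= eta * (kappa2 * enorm (g x)).
  rewrite (le_trans (dotv_le_enorm _ _)) // ler_pM ?enorm_ge0 //.
  exact: ltW.
have etaE : eta * (kappa2 * enorm (g x)) = (1 - c) * (kappa1 * (eps * enorm (g x))).
  by rewrite /eta; field; rewrite gt_eqF.
have e2 : eps * enorm (g x) <= enorm (g x) ^+ 2 by rewrite expr2 ler_wpM2r.
have e3 : kappa1 * (eps * enorm (g x)) <= - dotv (g x) d.
  by rewrite lerNr (le_trans gd) // mulNr lerN2 ler_pM2l.
have : (1 - c) * (kappa1 * (eps * enorm (g x))) <= (1 - c) * - dotv (g x) d.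
  by rewrite ler_pM2l // subr_gt0.
by lra.
Qed.

Lemma backtracking_gradient_cvg0 c rho abar kappa1 kappa2
    (x d : nat -> 'cV[R]_p) (alpha : nat -> R) :
  0 < c < 1 -> 0 < rho < 1 -> 0 < abar -> 0 < kappa1 -> 0 < kappa2 ->
  (forall y, 0 <= J y) ->
  (forall k, K (x k)) ->
  (forall k, dotv (g (x k)) (d k) <= - kappa1 * enorm (g (x k)) ^+ 2) ->
  (forall k, enorm (d k) <= kappa2 * enorm (g (x k))) ->
  let arm k a := J (x k + a *: d k) <= J (x k) + c * a * dotv (g (x k)) (d k) in
  (forall k, exists i : nat, [/\ alpha k = rho ^+ i * abar, arm k (alpha k) &
     forall l : nat, (l < i)%N -> ~~ arm k (rho ^+ l * abar)]) ->
  (forall k, x k.+1 = x k + alpha k *: d k) ->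
  enorm (g (x k)) @[k --> \oo] --> (0 : R).
Proof.
move=> c01 /andP[rho0 rho1] abar0 k10 k20 J0 Kx gd dg arm step xS.
have c0 : 0 < c by case/andP: c01.
have alpha0 k : 0 < alpha k.
  by have [i [-> _ _]] := step k; rewrite mulr_gt0 // exprn_gt0.
have dec k : J (x k.+1) <= J (x k) - c * alpha k * kappa1 * enorm (g (x k)) ^+ 2.
  have [i [_ h _]] := step k; rewrite xS (le_trans h) // lerD2l.
  by rewrite -[_ * kappa1 * _]mulrA -mulrN ler_pM2l ?mulr_gt0 // -mulNr.
have dec0 k : J (x k.+1) <= J (x k).
  rewrite (le_trans (dec k)) // gerBl.
  by rewrite mulr_ge0 ?sqr_ge0 // !mulr_ge0 // ltW.
have Jcvg : cvgn (fun k => J (x k)).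
  apply: nonincreasing_is_cvgn.
    by apply/nonincreasing_seqP.
  by exists 0 => _ [k _ <-].
(* The values of [J] decrease and are bounded below, so they converge and consecutive differences
   vanish. *)
have diff0 : J (x k) - J (x k.+1) @[k --> \oo] --> (0 : R).
  rewrite -(subrr (limn (fun k => J (x k)))); apply: cvgB => //.
  by rewrite (cvg_shiftS (fun k => J (x k))).
apply/cvgrPdist_lt => eps eps0.
have [tau tau0 htau] := armijo_uniform c01 k10 k20 eps0.
(* Lower bound on an accepted step when [eps <= enorm (g (x k))]: either the first trial [abar] is
   accepted, or the trial just before was rejected, hence longer than [tau], and the accepted one is
   [rho] times it. *)
pose amin := Num.min abar (rho * tau).
have amin0 : 0 < amin by rewrite lt_min abar0 mulr_gt0.
have q0 : 0 < c * amin * kappa1 * eps ^+ 2 by rewrite !mulr_gt0 // exprn_gt0.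
near=> k.
rewrite sub0r normrN ger0_norm ?enorm_ge0 // ltNge; apply/negP => epsg.
have amk : amin <= alpha k.
  have [[|i] [aE ak nak]] := step k; first by rewrite aE mul1r ge_min lexx.
  have /negP big := nak i (ltnSn i).
  rewrite ge_min; apply/orP; right; rewrite leNgt; apply/negP => small.
  have ai0 : 0 < rho ^+ i * abar by rewrite mulr_gt0 // exprn_gt0.
  apply: big; rewrite /arm htau // ai0 /=.
  by move: small; rewrite aE exprS -mulrA ltr_pM2l // => /ltW.
(* The right-hand side is the decrease guaranteed by a large gradient and a step of length at least
   [amin], whence the contradiction. *)
have : J (x k) - J (x k.+1) < c * amin * kappa1 * eps ^+ 2.
  by near: k; have /cvgr_lt/(_ _ q0) := diff0.
apply/negP; rewrite -leNgt lerBrDr addrC -lerBrDr (le_trans (dec k)) //.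
rewrite lerD2l lerN2 -!(mulrA c) -!mulrA ler_pM2l //.
apply: ler_pM => //; first exact: ltW.
  by apply: mulr_ge0; [exact: ltW | exact: sqr_ge0].
by rewrite ler_pM2l // ler_pXn2r ?nnegrE ?enorm_ge0 // ltW.
Unshelve. all: by end_near. Qed.

End Descent.

(** * Residuals, objective and quadratic model of the 4D-Var problem *)

Section WeakConstraint4DVar.
Variables (R : realType) (N n : nat) (m : 'I_N.+1 -> nat).
Variable P : wc4dvar R n m.
Hypothesis hP : wc4dvar_regular P.

Notation state := ('cV[R]_(sdim N n)).
Notation D := (Dmx P).
Notation W := (Rmx P).
Implicit Types (x v : state).

Lemma blk_linear j : linear (fun x : state => blk x j).
Proof. by move=> a u v; apply/matrixP => i k; rewrite !mxE. Qed.

Lemma is_derive_comp_blk (V : normedModType R) (f : 'cV[R]_n -> V) df x v j :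
  is_derive (blk x j) (blk v j) f df -> is_derive x v (fun y => f (blk y j)) df.
Proof. by move=> fd; exact: is_derive_comp_linear (blk_linear j) fd. Qed.

Lemma is_derive_blk x v j : is_derive x v (fun y => blk y j) (blk v j).
Proof. exact: is_derive_comp_blk (is_derive_id _ _). Qed.

Lemma continuous_blk j : continuous (fun x : state => blk x j).
Proof.
move=> x; apply/(@cvg_mxP R _ (nbhs x)) => i k.
rewrite mxE; under eq_cvg do rewrite mxE.
exact: (@coord_continuous _ _ _ (tagnat.Rank j i) k x).
Qed.

Lemma Lmx_mul x v : Lmx P x *m v = \mxcol_(i < N.+1)
  (if unlift ord0 i is Some l
   then blk_succ v l - jac (model P l) (blk_pred x l) *m blk_pred v l
   else blk v ord0).
Proof.
rewrite -[v in LHS](submxcolK (p_ := fun _ : 'I_N.+1 => n)).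
rewrite /Lmx (mul_mxblock_mxrow (p_ := fun _ => n) (q_ := fun _ => n)).
apply: (eq_mxcol (p_ := fun _ => n)) => i.
case: unliftP => [l ->|->]; last first.
  rewrite (bigD1 ord0) //= mul1mx big1 ?addr0 // => j /negPf j0.
  by rewrite eq_sym j0 mul0mx.
have wl : widen_ord (leqnSn N) l != lift ord0 l.
  by rewrite -val_eqE /= /bump /= add1n neq_ltn ltnSn.
rewrite (bigD1 (lift ord0 l)) //= eqxx mul1mx; congr (_ + _).
rewrite (bigD1 (widen_ord (leqnSn N) l)) //= eq_sym (negPf wl) eqxx mulNmx.
rewrite big1 ?addr0 // => j /andP[/negPf jl /negPf jw].
by rewrite eq_sym jl -[j == l :> nat]/(j == widen_ord (leqnSn N) l) jw mul0mx.
Qed.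

Lemma Hmx_mul x v : Hmx P x *m v =
  \mxcol_(i < N.+1) (jac (obsop P i) (blk x i) *m blk v i).
Proof.
rewrite -[v in LHS](submxcolK (p_ := fun _ : 'I_N.+1 => n)).
rewrite /Hmx (mul_mxblock_mxrow (p_ := fun _ => n)).
apply: eq_mxcol => i; rewrite (bigD1 i) //= eqxx big1 ?addr0 // => j /negPf ji.
by rewrite eq_sym ji mul0mx.
Qed.

(** Forward substitution: block row 0 gives the first block of [v], and each later row expresses a
    block through the preceding one. *)
Lemma Lmx_inj x v : Lmx P x *m v = 0 -> v = 0.
Proof.
rewrite Lmx_mul => L0.
have {}L0 i := congr1 (fun u => blk u i) L0.
suff v0 k : forall i : 'I_N.+1, i = k :> nat -> blk v i = 0.
  apply/(mxcolP (p_ := fun _ => n)) => i; rewrite submxcol0; exact: v0.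
elim: k => [|k IHk] i ik.
  have -> : i = ord0 by exact/val_inj.
  by have := L0 ord0; rewrite /blk mxcolK unlift_none submxcol0.
case: (unliftP ord0 i) ik => [l ->|->] //=; rewrite /bump /= add1n => -[lk].
have := L0 (lift ord0 l); rewrite {1}/blk mxcolK liftK /blk_pred.
rewrite (IHk (widen_ord _ l)) // mulmx0 subr0 => h.
by rewrite -[LHS]/(blk_succ v l) h /blk submxcol0.
Qed.

(** [- Lmx P x] is the Jacobian of the residual [bvec P]; this is what links the Gauss-Newton model
    to the gradient of the objective. *)
Lemma is_derive_bvec x v : is_derive x v (bvec P) (- (Lmx P x *m v)).
Proof.
case: hP => _ Mreg _ _ _; rewrite Lmx_mul -(mxcolN (p_ := fun _ => n)).
apply: (is_derive_mxcol (p_ := fun _ => n)) => i.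
case: unlift => [l|]; last first.
  rewrite -[X in is_derive _ _ _ X]sub0r; apply: is_deriveB.
  exact: is_derive_blk.
rewrite opprB; apply: is_deriveB; last exact: is_derive_blk.
by apply: is_derive_comp_blk; apply: is_derive_jac; case: (Mreg l).
Qed.

Lemma is_derive_dvec x v : is_derive x v (dvec P) (- (Hmx P x *m v)).
Proof.
case: hP => Hreg _ _ _ _; rewrite Hmx_mul -mxcolN.
apply: is_derive_mxcol => i.
rewrite -[X in is_derive _ _ _ X]sub0r; apply: is_deriveB.
by apply: is_derive_comp_blk; apply: is_derive_jac; case: (Hreg i).
Qed.

Lemma model_continuous l : continuous (model P l).
Proof.
case: hP => _ Mreg _ _ _ x; apply: differentiable_continuous.
by case: (Mreg l).
Qed.

Lemma obsop_continuous i : continuous (obsop P i).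
Proof.
case: hP => Hreg _ _ _ _ x; apply: differentiable_continuous.
by case: (Hreg i).
Qed.

Lemma continuous_bvec : continuous (bvec P).
Proof.
move=> x; apply: (cvg_mxcol (F := nbhs x) (p_ := fun _ => n)) => i.
case: unlift => [l|].
  apply: cvgB; last exact: continuous_blk.
  by apply: cvg_comp; [exact: continuous_blk | exact: model_continuous].
by apply: cvgB; [exact: cvg_cst | exact: continuous_blk].
Qed.

Lemma continuous_dvec : continuous (dvec P).
Proof.
move=> x; apply: (cvg_mxcol (F := nbhs x)) => i; apply: cvgB; first exact: cvg_cst.
by apply: cvg_comp; [exact: continuous_blk | exact: obsop_continuous].
Qed.

Lemma continuous_Lmx : continuous (Lmx P).
Proof.
case: hP => _ Mreg _ _ _ x.
apply: (cvg_mxblock (F := nbhs x) (p_ := fun _ => n) (q_ := fun _ => n)) => i j.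
case: eqP => _; first exact: cvg_cst.
case: unlift => [l|]; last exact: cvg_cst.
case: eqP => _; last exact: cvg_cst.
apply: cvgN; apply: cvg_comp; first exact: continuous_blk.
by case: (Mreg l) => _; exact.
Qed.

Lemma continuous_Hmx : continuous (Hmx P).
Proof.
case: hP => Hreg _ _ _ _ x; apply: (cvg_mxblock (F := nbhs x) (q_ := fun _ => n)) => i j.
case: eqP => _; last exact: cvg_cst.
apply: cvg_comp; first exact: continuous_blk.
by case: (Hreg i) => _; exact.
Qed.

Lemma Dmx_spd : spd D.
Proof.
case: hP => _ _ Bspd Qspd _; apply: (spd_mxdiag (p_ := fun _ => n)) => i.
by case: unlift.
Qed.

Lemma Rmx_spd : spd W.
Proof. by case: hP => _ _ _ _ Rspd; exact: spd_mxdiag. Qed.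

(** The objective is a weighted sum of squares of the residuals [bvec] and [dvec], whose signs are
    opposite to those in [objJ], except in the model-error and observation-free sense that [wnorm2]
    ignores signs. *)
Lemma objJE x : objJ P x =
  2^-1 * wnorm2 (invmx D) (bvec P x) + 2^-1 * wnorm2 (invmx W) (dvec P x).
Proof.
case: hP => _ _ Bspd Qspd Rspd.
rewrite /Dmx (invmx_mxdiag (p_ := fun _ => n)); last first.
  by move=> i; apply: spd_unitmx; case: unlift.
rewrite /Rmx invmx_mxdiag; last by move=> i; exact: spd_unitmx.
rewrite (wnorm2_mxdiag (p_ := fun _ => n)) wnorm2_mxdiag big_ord_recl.
rewrite unlift_none -wnorm2N opprB mulrDr addrAC /objJ.
congr (_ + _ * _ + _ * _); apply: eq_bigr => i _.
  by rewrite -[LHS]wnorm2N opprB.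
by rewrite liftK -[LHS]wnorm2N opprB.
Qed.

(** Closed form of the gradient, by the chain rule through the two residuals. *)
Definition gradJ x : state :=
  - ((Lmx P x)^T *m (invmx D *m bvec P x) + (Hmx P x)^T *m (invmx W *m dvec P x)).

(** The constant Hessian of the quadratic model at [x]. *)
Definition gauss_newton_hess x : 'M[R]_(sdim N n) :=
  (Lmx P x)^T *m (invmx D *m Lmx P x) + (Hmx P x)^T *m (invmx W *m Hmx P x).

Lemma is_derive_objJ x v : is_derive x v (objJ P) (dotv (gradJ x) v).
Proof.
have [[Ds _] [Ws _]] := (spd_invmx Dmx_spd, spd_invmx Rmx_spd).
have -> : objJ P = 2^-1 \*: (fun y => wnorm2 (invmx D) (bvec P y)) +
                   2^-1 \*: (fun y => wnorm2 (invmx W) (dvec P y)).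
  by apply/funext => y; rewrite objJE.
rewrite /gradJ dotvNl dotvDl !dotv_mulmxl !trmxK opprD.
have db := is_derive_wnorm2 Ds (is_derive_bvec x v).
have dd := is_derive_wnorm2 Ws (is_derive_dvec x v).
rewrite [X in is_derive _ _ _ X](_ : _ =
  2^-1 *: (2 * dotv (invmx D *m bvec P x) (- (Lmx P x *m v))) +
  2^-1 *: (2 * dotv (invmx W *m dvec P x) (- (Hmx P x *m v)))).
  by apply: is_deriveD; apply: is_deriveZ.
by rewrite !dotvNr /GRing.scale /= !dotv_mulmxl; field.
Qed.

Lemma grad_objJ x : grad (objJ P) x = gradJ x.
Proof. by apply: grad_is_derive => v; exact: is_derive_objJ. Qed.

Lemma continuous_gradJ : continuous gradJ.
Proof.
have cst q (A : 'M[R]_q) x : (fun _ : state => A) @ x --> A by exact: cst_continuous.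
move=> x; have [cL cH] := (@continuous_Lmx x, @continuous_Hmx x).
have [cb cd] := (@continuous_bvec x, @continuous_dvec x).
exact: (cvgN (cvgD (cvg_mulmx (cvg_trmx cL) (cvg_mulmx (cst _ _ x) cb))
                   (cvg_mulmx (cvg_trmx cH) (cvg_mulmx (cst _ _ x) cd)))).
Qed.

Lemma continuous_gauss_newton_hess : continuous gauss_newton_hess.
Proof.
have cst q (A : 'M[R]_q) x : (fun _ : state => A) @ x --> A by exact: cst_continuous.
move=> x; have [cL cH] := (@continuous_Lmx x, @continuous_Hmx x).
exact: (cvgD (cvg_mulmx (cvg_trmx cL) (cvg_mulmx (cst _ _ x) cL))
             (cvg_mulmx (cvg_trmx cH) (cvg_mulmx (cst _ _ x) cH))).
Qed.

Lemma dotv_gauss_newton_hess x v : dotv v (gauss_newton_hess x *m v) =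
  wnorm2 (invmx D) (Lmx P x *m v) + wnorm2 (invmx W) (Hmx P x *m v).
Proof.
rewrite /gauss_newton_hess mulmxDl dotvDr /wnorm2 !dotv_mulmxl.
by rewrite !mulmxA.
Qed.

Lemma gauss_newton_hess_pos x v :
  v != 0 -> 0 < dotv v (gauss_newton_hess x *m v).
Proof.
move=> v0; rewrite dotv_gauss_newton_hess ltr_pwDl //; last first.
  exact/spd_ge0/spd_invmx/Rmx_spd.
have [_ Dpos] := spd_invmx Dmx_spd; apply: Dpos.
by apply: contra v0 => /eqP/Lmx_inj ->.
Qed.

(** The second-order expansion of the model at 0 is exact, because the model is quadratic. *)
Lemma qmodel_decrease x v : qmodel P x 0 - qmodel P x v =
  - dotv (gradJ x) v - 2^-1 * dotv v (gauss_newton_hess x *m v).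
Proof.
have [[Ds _] [Ws _]] := (spd_invmx Dmx_spd, spd_invmx Rmx_spd).
have wnorm2B q (A : 'M[R]_q) a b : A^T = A ->
    wnorm2 A (a - b) = wnorm2 A a - 2 * dotv (A *m b) a + wnorm2 A b.
  move=> As; rewrite /wnorm2 mulmxDr mulmxN !(dotvDl, dotvDr, dotvNl, dotvNr).
  rewrite [dotv b (A *m a)]dotvC dotv_mulmxl As [dotv a (A *m b)]dotvC.
  by rewrite [dotv (A *m b) a]dotv_mulmxl As [dotv b (A *m a)]dotvC
     dotv_mulmxl As [dotv a _]dotvC dotv_mulmxl As; ring.
rewrite dotv_gauss_newton_hess /qmodel !wnorm2B // !mulmx0 /gradJ.
have dot0 q (a : 'cV[R]_q) : dotv a 0 = 0 by rewrite /dotv mulmx0 mxE.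
rewrite dotvNl dotvDl !dotv_mulmxl !trmxK /wnorm2 !mulmx0 !dot0.
by field.
Qed.

(** The first two block rows determine [dl] and [dm]; substituting them in the third leaves the
    normal equations of the model. *)
Lemma saddle_solution_newton x dl dm v :
  saddle_solution P x dl dm v -> gauss_newton_hess x *m v = - gradJ x.
Proof.
have [Du Wu] := (spd_unitmx Dmx_spd, spd_unitmx Rmx_spd).
rewrite /saddle_solution !mul_block_col !mul_col_mx !mul_row_col !mul0mx.
rewrite !addr0 add0r add_col_mx => /eq_col_mx[/eq_col_mx[e1 e2] e3].
have dlE : dl = invmx D *m (bvec P x - Lmx P x *m v).
  by rewrite -e1 addrK mulKmx.
have dmE : dm = invmx W *m (dvec P x - Hmx P x *m v).
  by rewrite -e2 addrK mulKmx.
rewrite opprK /gauss_newton_hess mulmxDl -!mulmxA.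
apply/eqP; rewrite -subr_eq0 -oppr_eq0 -e3 dlE dmE !mulmxBr.
by rewrite opprB opprD addrACA.
Qed.

(** * Compactness of the sublevel sets *)

Lemma objJ_ge0 x : 0 <= objJ P x.
Proof.
rewrite objJE; have [Ds Ws] := (spd_invmx Dmx_spd, spd_invmx Rmx_spd).
by rewrite addr_ge0 // mulr_ge0 ?invr_ge0 ?spd_ge0.
Qed.

Lemma sublevel_bvec_bounded a :
  exists C, forall x i, objJ P x <= a -> `|blk (bvec P x) i| <= C.
Proof.
have [Ds Ws] := (spd_invmx Dmx_spd, spd_invmx Rmx_spd).
have [e e0 eD] := spd_lower_bound Ds.
(* From [e / 2 * dotv b b <= objJ P x <= a], where [b] is [bvec P x]. *)
exists (Num.sqrt (2 * a / e)) => x i; rewrite objJE => Jx.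
have Wd := spd_ge0 (dvec P x) Ws.
have bD := eD (bvec P x).
have bb : enorm (bvec P x) <= Num.sqrt (2 * a / e).
  by rewrite ler_wsqrtr // ler_pdivlMr //; lra.
apply: le_trans bb; apply: le_trans (normr_le_enorm _).
rewrite [leLHS]/Num.Def.normr /= mx_normrE bigmax_le // => -[k l] _ /=.
by rewrite mxE mx_entry_le_norm.
Qed.

(** Induction along the time windows: a block is the model image of the preceding block minus a
    bounded residual, and a continuous model is bounded on the compact ball containing that
    preceding block. *)
Lemma sublevel_blk_bounded a (i : 'I_N.+1) :
  exists C, forall x, objJ P x <= a -> `|blk x i| <= C.
Proof.
have [C bC] := sublevel_bvec_bounded a.
suff bnd k : forall i : 'I_N.+1, i = k :> nat ->
    exists C, forall x, objJ P x <= a -> `|blk x i| <= C by exact: (bnd i).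
elim: k => [|k IHk] {}i ik.
  have -> : i = ord0 by exact/val_inj.
  exists (`|bgd P| + C) => x Jx.
  have E : blk x ord0 = bgd P - blk (bvec P x) ord0.
    by rewrite [blk (bvec P x) _]mxcolK unlift_none subKr.
  by rewrite E (le_trans (ler_normB _ _)) // lerD2l bC.
case: (unliftP ord0 i) ik => [l ->|->] //=; rewrite /bump /= add1n => -[lk].
have [C' C'b] := IHk (widen_ord (leqnSn N) l) lk.
have cB : compact [set u : 'cV[R]_n | `|u| <= C'].
  apply: bounded_closed_compact_col.
    exists C'; split; first exact: num_real.
    by move=> y Cy u /= /le_trans; apply; exact: ltW.
  apply: (@preimage_closed _ _ (fun u : 'cV[R]_n => `|u|) [set t | t <= C']).
    by move=> u _; exact: norm_continuous.
  exact: closed_le.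
have [b b0 Mb] : exists2 b : R, 0 < b &
    forall u, `|u| <= C' -> `|model P l u| <= b.
  apply: (compact_ubound cB) => u.
  exact: (cvg_norm (@model_continuous l u)).
exists (b + C) => x Jx.
have E : blk x (lift ord0 l) = model P l (blk_pred x l) - blk (bvec P x) (lift ord0 l).
  by rewrite [blk (bvec P x) _]mxcolK liftK subKr.
rewrite E (le_trans (ler_normB _ _)) // lerD ?bC //.
by apply: Mb; exact: C'b.
Qed.

Lemma sublevel_compact a : compact [set x | objJ P x <= a].
Proof.
apply: bounded_closed_compact_col; last first.
  apply: (@preimage_closed _ _ (objJ P) [set t | t <= a]); last exact: closed_le.
  move=> x _; have -> : objJ P = fun y =>
      2^-1 * wnorm2 (invmx D) (bvec P y) + 2^-1 * wnorm2 (invmx W) (dvec P y).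
    by apply/funext => y; exact: objJE.
  have cst (T : topologicalType) (u : T) : (fun _ : state => u) @ x --> u.
    exact: cst_continuous.
  have [cb cd] := (@continuous_bvec x, @continuous_dvec x).
  exact: (cvgD (cvgM (cst _ _) (cvg_dotv cb (cvg_mulmx (cst _ _) cb)))
               (cvgM (cst _ _) (cvg_dotv cd (cvg_mulmx (cst _ _) cd)))).
have [C bC] := choice (sublevel_blk_bounded a).
(* The sum dominates each block bound; absolute values keep its terms nonnegative, as the sign of
   [C i] is unknown. *)
exists (\sum_i `|C i|); split; first exact: num_real.
move=> y Cy x /= Jx.
rewrite [leLHS]/Num.Def.normr /= mx_normrE.
have y0 : 0 <= y by rewrite ltW // (le_lt_trans _ Cy) // sumr_ge0.
rewrite bigmax_le // => -[k l] _ /=.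
rewrite -(submxcolK (p_ := fun _ : 'I_N.+1 => n) x) mxE.
set j := tagnat.sig1 k.
rewrite (le_trans (mx_entry_le_norm _ _ _)) // (le_trans (bC j x Jx)) //.
rewrite (le_trans (ler_norm _)) // ltW // (le_lt_trans _ Cy) //.
by rewrite (bigD1 j) //= lerDl sumr_ge0.
Qed.

End WeakConstraint4DVar.

(** * Global convergence of the outer iteration *)

Theorem mainTheorem1 (R : realType) (N n : nat) (m : 'I_N.+1 -> nat)
    (P : wc4dvar R n m)
    (epsq : R) (theta : nat -> R) (abar rho c : R)
    (x dx : nat -> 'cV[R]_(sdim N n)) (alpha : nat -> R)
    (hN : (1 <= N)%N) (hn : (1 <= n)%N)
    (hP : wc4dvar_regular P)
    (hepsq : 0 < epsq < 1)
    (htheta_ge0 : forall j : nat, (1 <= j)%N -> 0 <= theta j)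
    (htheta_lim : theta @ \oo --> (0 : R))
    (habar : 0 < abar) (hrho : 0 < rho < 1) (hc : 0 < c < 1)
    (hrun : saddle_run P epsq theta abar rho c x dx alpha) :
  let g := fun k : nat => grad (objJ P) (x k) in
  [/\ exists kappa1 kappa2 : R,
        [/\ 0 < kappa1, kappa1 <= kappa2
          & forall k : nat,
              dotv (g k) (dx k) <= - kappa1 * enorm (g k) ^+ 2 /\
              enorm (dx k) <= kappa2 * enorm (g k)],
      forall k : nat, objJ P (x k.+1) <= objJ P (x k)
    & (exists K : R, forall k : nat,
          condnum (hess (qmodel P (x k)) 0) <= K) ->
      enorm (g k) @[k --> \oo] --> (0 : R)].
Proof.
have rho0 : 0 < rho by case/andP: hrho.
have c0 : 0 < c by case/andP: hc.
have eps0 : 0 < epsq by case/andP: hepsq.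
move=> g; pose K := [set y | objJ P y <= objJ P (x 0)].
have cK : compact K by exact: sublevel_compact.
have gE k : g k = gradJ P (x k) by exact: grad_objJ.
have [k1 [k2 [k10 k12 related]]] := gauss_newton_gradient_related cK
  (continuous_gradJ hP) (continuous_gauss_newton_hess hP)
  (fun y v _ v0 => gauss_newton_hess_pos hP y v0) eps0.
(* The constants are fixed on the initial sublevel set before the iterates are known to stay there.
   The step bounds and the decrease are thus proved under [K (x k)], and the induction in [Kx]
   discharges that condition. *)
have step k : K (x k) -> dotv (g k) (dx k) <= - k1 * enorm (g k) ^+ 2 /\
                         enorm (dx k) <= k2 * enorm (g k).
  move=> Kx; rewrite gE; apply: related => //.
  have [[j [dl [dm [j1 [q|/(saddle_solution_newton hP) s]]]]] _ _]
    := hrun k; last by right.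
  left; rewrite -qmodel_decrease // -gE; apply: le_trans q.
  by rewrite le_max lexx.
have decrease k : K (x k) -> objJ P (x k.+1) <= objJ P (x k).
  move=> Kx; have [_ [i [aE ak _]] ->] := hrun k.
  have [gd _] := step k Kx; rewrite (le_trans ak) // gerDl.
  rewrite mulr_ge0_le0 ?(le_trans gd) //.
    by rewrite aE mulr_ge0 ?(ltW c0) // mulr_ge0 ?exprn_ge0 // ltW.
  by rewrite mulNr oppr_le0 mulr_ge0 ?sqr_ge0 // ltW.
have Kx k : K (x k).
  by elim: k => [|k IHk]; [exact: lexx | exact: le_trans (decrease k IHk) IHk].
split; first by exists k1, k2; split=> // k; exact: step.
  by move=> k; exact: decrease.
move=> _; rewrite (_ : (fun k => enorm (g k)) = fun k => enorm (gradJ P (x k))).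
  apply: (backtracking_gradient_cvg0 (d := dx) (alpha := alpha) cK (continuous_gradJ hP)
    (is_derive_objJ hP) hc hrho habar k10 (lt_le_trans k10 k12) (objJ_ge0 hP) Kx).
  - by move=> k; rewrite -gE; case: (step k (Kx k)).
  - by move=> k; rewrite -gE; case: (step k (Kx k)).
  - move=> k; have [_ [i [aE ak nak]] _] := hrun k.
    by exists i; split=> //; rewrite -?gE.
  - by move=> k; case: (hrun k).
by apply/funext => k; rewrite gE.
Qed.
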